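(* Let $S=K[x_1,\dots,x_n]$ be a polynomial ring over a field $K$, let $2\leq i\leq n-1$, and let $Z_i=\operatorname{Im}\partial_i$, where $\partial_i:K_i\to K_{i-1}$ is the differential of the Koszul complex on $x_1,\dots,x_n$. Let $F$ be a free submodule of $K_i$ generated by a subset of the canonical basis of $K_i$ such that the sequence $$0\to F\xrightarrow{\partial_i|_F}Z_i\to Z_i/\partial_i(F)\to 0$$ is a graded Bourbaki sequence of $Z_i$. Then $$i\geq\max\left\{i\binom{n-1}{i-1}-n\binom{n-1}{i-2},\ (n-i)\binom{n-1}{i}-n\binom{n-1}{i+1}\right\}.$$
   Context: The Koszul complex on $x_1,\dots,x_n$ is $0\to K_n\xrightarrow{\partial_n}K_{n-1}\to\cdots\to K_1\xrightarrow{\partial_1}K_0=S$, with $K_j=\bigwedge^j S^n$; the canonical basis of $K_j$ consists of the elements $\mathbf e_{i_1\dots i_j}=\mathbf e_{i_1}\wedge\dots\wedge\mathbf e_{i_j}$, $1\leq i_1<\dots<i_j\leq n$ (of degree $j$), and $\partial(\mathbf e_{i_1\dots i_j})=\sum_{k=1}^{j}(-1)^{k+1}x_{i_k}\mathbf e_{i_1\dots\widehat{i_k}\dots i_j}$. A graded Bourbaki sequence of a graded module $M$ is a short exact sequence $0\to F\to M\to N\to 0$ of graded modules with $F$ graded free and $N$ isomorphic to a shift $I(m)$ of a graded ideal $I$ of $S$. Convention: $\binom{a}{b}=0$ if $b>a\ge 0$. *)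

(* Defs.v *)
From HB Require Import structures.
From mathcomp Require Import all_boot all_order all_algebra.
From mathcomp Require Import boolp.
From mathcomp Require Import mpoly.

Set Implicit Arguments.
Unset Strict Implicit.
Unset Printing Implicit Defensive.

Import GRing.Theory.
Local Open Scope ring_scope.
Local Open Scope quotient_scope.

Section Submodules.
Variables (R : pzRingType) (V : lmodType R) (P : submodClosed V).

Record submod_of := Submod { submod_val :> V; _ : submod_val \in P }.

HB.instance Definition _ := [isSub for submod_val].
HB.instance Definition _ := [Choice of submod_of by <:].
HB.instance Definition _ := [SubChoice_isSubLmodule of submod_of by <:].

Lemma submod_val_is_linear : linear submod_val.
Proof. by []. Qed.

HB.instance Definition _ :=
  GRing.isLinear.Build R submod_of V *:%R submod_val submod_val_is_linear.

(* submodClosed is stated for semimodules and does not provide the instance of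
   zmodClosed on P required by Quotient.quot. *)
Definition quot_pred : {pred V} := [pred v | v \in P].

Fact quot_pred_zmod_closed : zmod_closed quot_pred.
Proof.
split=> [|v w]; rewrite !inE ?rpred0 // => vP wP.
by rewrite -scaleN1r rpredD ?rpredZ.
Qed.

HB.instance Definition _ := GRing.isZmodClosed.Build V quot_pred
  quot_pred_zmod_closed.

Definition quotmod : Type := Quotient.quot quot_pred.

HB.instance Definition _ := GRing.Zmodule.on quotmod.
HB.instance Definition _ := EqQuotient.on quotmod.
HB.instance Definition _ := ZmodQuotient.on quotmod.

Definition quot_proj (v : V) : quotmod := \pi v.

Definition quot_scale (a : R) (q : quotmod) : quotmod :=
  quot_proj (a *: repr q).

Lemma quot_proj_eq v w : (quot_proj v = quot_proj w) <-> (v - w \in P).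
Proof.
rewrite /quot_proj; split => [/eqP|h]; rewrite -?Quotient.idealrBE //.
by apply/eqP; rewrite -Quotient.idealrBE.
Qed.

Lemma quot_proj_is_zmod_morphism : zmod_morphism quot_proj.
Proof. by move=> v w; rewrite /quot_proj raddfB. Qed.

HB.instance Definition _ :=
  GRing.isZmodMorphism.Build V quotmod quot_proj quot_proj_is_zmod_morphism.

Lemma quot_projK q : quot_proj (repr q) = q.
Proof. exact: reprK. Qed.

Lemma quot_proj_scale a v : quot_proj (a *: v) = quot_scale a (quot_proj v).
Proof.
apply/quot_proj_eq; rewrite -scalerBr rpredZ //.
by apply/quot_proj_eq; rewrite quot_projK.
Qed.

Fact quot_scaleA a b q : quot_scale a (quot_scale b q) = quot_scale (a * b) q.
Proof. by rewrite -(quot_projK q) -!quot_proj_scale scalerA. Qed.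

Fact quot_scale1 : left_id 1 quot_scale.
Proof. by move=> q; rewrite -(quot_projK q) -!quot_proj_scale scale1r. Qed.

Fact quot_scaleDr : right_distributive quot_scale +%R.
Proof.
move=> a p q; rewrite -(quot_projK q) -(quot_projK p).
by rewrite -raddfD -!quot_proj_scale scalerDr raddfD.
Qed.

Fact quot_scaleDl q : {morph quot_scale^~ q : a b / a + b}.
Proof.
move=> a b; rewrite -(quot_projK q) -!quot_proj_scale.
by rewrite scalerDl raddfD.
Qed.

HB.instance Definition _ := GRing.Zmodule_isLmodule.Build R quotmod
  quot_scaleA quot_scale1 quot_scaleDr quot_scaleDl.

Lemma quot_proj_is_scalable : scalable quot_proj.
Proof. exact: quot_proj_scale. Qed.

HB.instance Definition _ :=
  GRing.isScalable.Build R V quotmod *:%R quot_proj quot_proj_is_scalable.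

End Submodules.

Section Image.
Variables (R : pzRingType) (U V : lmodType R) (f : {linear U -> V}).

Definition img : {pred V} := [pred v | `[< exists u, v = f u >]].

Lemma imgP v : reflect (exists u, v = f u) (v \in img).
Proof. exact: asboolP. Qed.

Fact img_submod_closed : submod_closed img.
Proof.
split=> [|a _ _ /imgP[u ->] /imgP[w ->]]; apply/imgP.
  by exists 0; rewrite raddf0.
by exists (a *: u + w); rewrite linearP.
Qed.

HB.instance Definition _ := GRing.isSubmodClosed.Build R V img
  img_submod_closed.

Lemma mem_img u : f u \in img.
Proof. by apply/imgP; exists u. Qed.

Definition corestr (u : U) : submod_of img := Submod (mem_img u).

Lemma corestr_is_linear : linear corestr.
Proof. by move=> a u w; apply: val_inj; rewrite /= linearP. Qed.

HB.instance Definition _ := GRing.isLinear.Build R U (submod_of img) *:%R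
  corestr corestr_is_linear.

End Image.

Section Span.
Variables (R : pzRingType) (V : lmodType R) (I : finType).
Variables (B : {set I}) (b : I -> V).

Definition span : {pred V} :=
  [pred v | `[< exists c : I -> R, v = \sum_(k in B) c k *: b k >]].

Lemma spanP v :
  reflect (exists c : I -> R, v = \sum_(k in B) c k *: b k) (v \in span).
Proof. exact: asboolP. Qed.

Fact span_submod_closed : submod_closed span.
Proof.
split=> [|a _ _ /spanP[c ->] /spanP[d ->]]; apply/spanP.
  by exists (fun=> 0); rewrite big1 // => k _; rewrite scale0r.
exists (fun k => a * c k + d k); rewrite scaler_sumr -big_split /=.
by apply: eq_bigr => k _; rewrite scalerA scalerDl.
Qed.

HB.instance Definition _ := GRing.isSubmodClosed.Build R V span
  span_submod_closed.

End Span.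

Section GradedModules.
Variables (K : fieldType) (n : nat).
Local Notation S := {mpoly K[n]}.

Definition poly_gr (d : int) (p : S) : Prop :=
  match d with Posz k => p \is k.-homog | Negz _ => p = 0 end.

Record graded_module (V : lmodType S) (gr : int -> V -> Prop) : Prop := {
  gr_0 : forall d, gr d 0;
  gr_B : forall d u v, gr d u -> gr d v -> gr d (u - v);
  gr_Z : forall e d p v, poly_gr e p -> gr d v -> gr (e + d) (p *: v);
  gr_sum : forall v, exists (s : seq int) (c : int -> V),
    [/\ uniq s, forall d, gr d (c d) & v = \sum_(d <- s) c d];
  gr_direct : forall (s : seq int) (c : int -> V), uniq s ->
    (forall d, gr d (c d)) -> \sum_(d <- s) c d = 0 ->
    forall d, d \in s -> c d = 0
}.

Definition graded_hom (V W : lmodType S) (grV : int -> V -> Prop)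
    (grW : int -> W -> Prop) (f : V -> W) : Prop :=
  forall d v, grV d v -> grW d (f v).

Definition graded_isomorphic (V W : lmodType S) (grV : int -> V -> Prop)
    (grW : int -> W -> Prop) : Prop :=
  exists f : {linear V -> W},
    bijective f /\ forall d v, grV d v <-> grW d (f v).

Definition shift_gr (V : Type) (m : int) (gr : int -> V -> Prop)
    (d : int) : V -> Prop := gr (m + d).

Definition sub_gr (V : lmodType S) (gr : int -> V -> Prop)
    (P : submodClosed V) (d : int) (v : submod_of P) : Prop :=
  gr d (submod_val v).

Definition quot_gr (V : lmodType S) (gr : int -> V -> Prop)
    (P : submodClosed V) (d : int) (q : quotmod P) : Prop :=
  exists2 v, gr d v & q = quot_proj P v.

Definition graded_free (V : lmodType S) (gr : int -> V -> Prop) : Prop :=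
  exists (r : nat) (b : 'I_r -> V) (deg : 'I_r -> int),
    (forall k, gr (deg k) (b k)) /\
    (forall v, exists! c : {ffun 'I_r -> S}, v = \sum_k c k *: b k).

(* Ideals of S are the S-submodules of the regular module S^o; the unit ideal
   is allowed, unlike in MathComp's idealr. *)
Definition graded_ideal (I : submodClosed S^o) : Prop :=
  forall (p : S) (d : nat), p \in I -> pihomog mdeg d p \in I.

Record bourbaki_sequence (F M N : lmodType S) (grF : int -> F -> Prop)
    (grM : int -> M -> Prop) (grN : int -> N -> Prop)
    (f : {linear F -> M}) (g : {linear M -> N}) : Prop := {
  bs_gradedF : graded_module grF;
  bs_gradedM : graded_module grM;
  bs_gradedN : graded_module grN;
  bs_homf : graded_hom grF grM f;
  bs_homg : graded_hom grM grN g;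
  bs_injective : injective f;
  bs_exact : forall y, g y = 0 <-> exists x, y = f x;
  bs_surjective : forall z, exists y, z = g y;
  bs_free : graded_free grF;
  bs_ideal : exists (I : submodClosed S^o) (m : int),
    graded_ideal I /\
    graded_isomorphic grN (shift_gr m (@sub_gr S^o poly_gr I))
}.

End GradedModules.

Section Koszul.
Variables (K : fieldType) (n : nat).
Local Notation S := {mpoly K[n]}.

Definition ksub (j : nat) : finType := {A : {set 'I_n} | #|A| == j}.

(* The j-th exterior power of S^n, in coordinates with respect to the canonical
   basis: the element e_{i_1...i_j}, i_1 < ... < i_j, is indexed by the set
   {i_1, ..., i_j}. *)
Definition koszul (j : nat) : lmodType S := {ffun ksub j -> S^o}.

(* e_A; it is only meaningful (and otherwise 0) when #|A| = j *)
Definition kbasis (j : nat) (A : {set 'I_n}) : koszul j :=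
  [ffun B : ksub j => (val B == A)%:R].

(* If a is the k-th smallest element of A then k - 1 elements of A are smaller
   than a, whence the sign (-1)^(k+1). The map out of koszul 0 is zero. *)
Definition kdiff_basis (j : nat) (A : {set 'I_n}) : koszul j.-1 :=
  \sum_(a in A)
    ((-1) ^+ #|[set b in A | (b < a)%N]| * 'X_a : S) *: kbasis j.-1 (A :\ a).

Definition kdiff (j : nat) (u : koszul j) : koszul j.-1 :=
  \sum_(A : ksub j) (u A : S) *: kdiff_basis j (val A).

Lemma kdiff_is_linear j : linear (@kdiff j).
Proof.
move=> a u v; rewrite /kdiff scaler_sumr -big_split /=.
by apply: eq_bigr => A _; rewrite scalerA !ffunE scalerDl.
Qed.

HB.instance Definition _ j := GRing.isLinear.Build S (koszul j) (koszul j.-1)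
  *:%R (@kdiff j) (@kdiff_is_linear j).

(* e_A has degree #|A| = j *)
Definition koszul_gr (j : nat) (d : int) (u : koszul j) : Prop :=
  forall A : ksub j, poly_gr (d - j%:Z) (u A : S).

Definition cycles (j : nat) : lmodType S := submod_of (img (@kdiff j)).

Definition cycles_gr (j : nat) : int -> cycles j -> Prop :=
  sub_gr (@koszul_gr j.-1) (P := img (@kdiff j)).

Section BasisSubmodule.
Variables (j : nat) (B : {set ksub j}).

Definition kspan : submodClosed (koszul j) :=
  span B (fun A => kbasis j (val A)).

Definition kspan_gr : int -> submod_of kspan -> Prop :=
  sub_gr (@koszul_gr j) (P := kspan).

Definition kdiff_restr : {linear submod_of kspan -> cycles j} :=
  corestr (@kdiff j) \o @submod_val _ _ kspan.

Definition kquot : lmodType S := quotmod (img kdiff_restr).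

Definition kquot_gr : int -> kquot -> Prop :=
  quot_gr (@cycles_gr j) (P := img kdiff_restr).

Definition kquot_proj : {linear cycles j -> kquot} :=
  quot_proj (img kdiff_restr).

End BasisSubmodule.
End Koszul.

(* Main.v *)
Require Import Defs.
From HB Require Import structures.
From mathcomp Require Import all_boot all_order all_algebra.
From mathcomp Require Import mpoly zify.

(** Up to monomial factors the Koszul differential is the boundary of the full
    simplex on n vertices: multiplying e_T by the product of the variables
    outside T turns one into the other. So linear algebra over K on the simplex
    produces explicit elements of the Koszul complex, and the quotient Z_i / F,
    being isomorphic to an ideal, can only tolerate few of them. Two
    inequalities on B result.

    - An ideal has rank at most 1, so that #|B| is at least the rank
      'C(n-1, i-1) of Z_i minus 1 ([card_basis_ge]). If B were smaller, two
      cochains over K would have independent coboundaries that vanish on B,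
      and the corresponding linear forms would make two generators of Z_i
      independent modulo F ([exists_cocycle_on], [cocycle_detects]).

    - An ideal is torsion free. If more than 'C(n-2, i-2) elements of B contain
      k, then a chain w on the simplex without the vertex k has its nonzero
      boundary supported on the link of k in B ([exists_chain_bd_support]).
      Coning that boundary with k gives an element G of F whose differential
      is 'X_k times an element of Z_i. By torsion freeness and injectivity, G
      is divisible by 'X_k in F, although its nonzero coefficients do not
      involve 'X_k ([card_link_le]).

    Each element of B contains i vertices, so that summing the second bound
    over k gives i * #|B| <= n * 'C(n-2, i-2). With the first bound this
    becomes i * 'C(n-1, i-1) - n * 'C(n-2, i-2) <= i, whose left side equals
    'C(n-2, i-1). Both terms of the maximum are at most 'C(n-2, i-1)
    ([binomial_bounds]). *)

Set Implicit Arguments.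
Unset Strict Implicit.
Unset Printing Implicit Defensive.

Import Order.TTheory GRing.Theory Num.Theory.
Local Open Scope ring_scope.

(** * Underdetermined linear systems *)

Lemma linear_kernel_support (K : fieldType) (I J : finType) (X : {set I})
    (Y : {set J}) (f : {linear {ffun I -> K^o} -> {ffun J -> K^o}}) :
  (#|Y| < #|X|)%N ->
  exists u : {ffun I -> K^o}, [/\ exists2 i, i \in X & u i != 0,
    forall i, i \notin X -> u i = 0 & forall j, j \in Y -> f u j = 0].
Proof.
move=> ltYX.
pose d i : {ffun I -> K^o} := [ffun i' => (i' == i)%:R].
pose M := \matrix_(a < #|X|, b < #|Y|) (f (d (enum_val a)) (enum_val b) : K).
have /rowV0Pn[r /sub_kermxP rM r_neq0] : kermx M != 0.
  by rewrite kermx_eq0 /row_free neq_ltn (leq_ltn_trans (rank_leq_col M) ltYX).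
pose u : {ffun I -> K^o} := \sum_a r 0 a *: d (enum_val a).
have uE a : u (enum_val a) = r 0 a.
  rewrite sum_ffunE (bigD1 a) //= !ffunE eqxx big1 ?addr0 => [|b b_neq].
    exact: mulr1.
  by rewrite !ffunE (inj_eq enum_val_inj) eq_sym (negPf b_neq) scaler0.
exists u; split=> [|i iX|j jY].
- have [a ra] : exists a, r 0 a != 0.
    apply/existsP; rewrite -negb_forall; apply: contra r_neq0 => /forallP r0.
    by apply/eqP/rowP => a; rewrite mxE; apply/eqP.
  by exists (enum_val a); rewrite ?enum_valP ?uE.
- rewrite sum_ffunE big1 // => a _; rewrite !ffunE.
  case: eqP => [ia|_]; last exact: scaler0.
  by rewrite ia enum_valP in iX.
- transitivity ((r *m M) 0 (enum_rank_in jY j)); last by rewrite rM mxE.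
  rewrite linear_sum sum_ffunE mxE; apply: eq_bigr => a _.
  by rewrite linearZ !ffunE mxE enum_rankK_in.
Qed.

(** * Chains on the simplex *)

(** A chain assigns a coefficient to every subset of 'I_n, whatever its
    cardinality; working with all degrees at once avoids dependent types. The
    weights x are 1 for the simplicial boundary and the variables for the
    Koszul differential. *)
Section Chains.
Variables (R : comNzRingType) (n : nat).
Local Notation chain := {ffun {set 'I_n} -> R^o}.
Implicit Types (a b k : 'I_n) (T A : {set 'I_n}) (w z c : chain).

Fact scale_regE (s : R) (y : R^o) : s *: y = s * y.
Proof. by []. Qed.

Definition sgn (a : 'I_n) (T : {set 'I_n}) : R :=
  (-1) ^+ #|[set b in T | (b < a)%N]|.

Lemma sgn_sqr a T : sgn a T * sgn a T = 1.
Proof. by rewrite -expr2 sqrr_sign. Qed.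

Lemma sgnU1 a b T : a \notin T -> sgn b (a |: T) = (-1) ^+ (a < b)%N * sgn b T.
Proof.
move=> aT; rewrite /sgn -exprD; congr (_ ^+ _).
rewrite (cardsD1 a) !inE eqxx /=; congr (_ + _)%N; apply: eq_card => c.
by rewrite !inE; case: eqP => [->|] //=; rewrite (negPf aT).
Qed.

Lemma sgnD1 a T : sgn a (T :\ a) = sgn a T.
Proof.
rewrite /sgn; congr (_ ^+ _); apply: eq_card => c.
by rewrite !inE; case: eqP => [->|] //=; rewrite ltnn !andbF.
Qed.

Lemma sgn_exchange a b T : a != b -> a \notin T -> b \notin T ->
  sgn a (b |: T) * sgn b (a |: T) = - (sgn a T * sgn b T).
Proof.
move=> ab aT bT; rewrite !sgnU1 // mulrACA -signr_addb -[RHS]mulN1r.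
congr (_ * _); move: ab; rewrite -(inj_eq val_inj).
by case: ltngtP => //= _ _; rewrite ?expr1.
Qed.

Lemma sgn_swap a b T : a != b -> a \notin T -> b \notin T ->
  sgn a T * sgn b (a |: T) = - (sgn b T * sgn a (b |: T)).
Proof.
move=> ab aT bT; rewrite -[sgn b (a |: T)]mul1r -(sgn_sqr a (b |: T)) -mulrA.
rewrite sgn_exchange // !mulrN mulrCA (mulrA (sgn a T)) sgn_sqr mul1r.
by rewrite mulrC.
Qed.

(** The terms cancel in pairs; nothing is divided by 2, so that this holds in
    every characteristic. *)
Lemma sum_antisym (P : pred 'I_n) (F : 'I_n -> 'I_n -> R) :
  (forall a b, P a -> P b -> a != b -> F a b = - F b a) ->
  \sum_(a | P a) \sum_(b | P b && (a != b)) F a b = 0.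
Proof.
move=> anti.
have split_lt a : \sum_(b | P b && (a != b)) F a b =
    \sum_(b | P b && (a < b)%N) F a b + \sum_(b | P b && (b < a)%N) F a b.
  rewrite (bigID (fun b => (a < b)%N)) /=; congr (_ + _); apply: eq_bigl => b;
    by rewrite -(inj_eq val_inj) -andbA; case: ltngtP.
under eq_bigr do rewrite split_lt.
rewrite big_split /= [X in _ + X](exchange_big_dep P) /=; last first.
  by move=> a b _ /andP[].
rewrite -big_split big1 //= => a Pa.
rewrite -[X in _ + X]opprK -sumrN.
apply/eqP; rewrite subr_eq0; apply/eqP; apply: eq_big => [b|b /andP[Pb ab]].
  by rewrite Pa.
by apply: anti => //; rewrite -(inj_eq val_inj) neq_ltn ab.
Qed.

Section Boundary.
Variable x : 'I_n -> R.

Definition bd w : chain :=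
  [ffun T : {set 'I_n} => \sum_(a | a \notin T) sgn a T * x a * w (a |: T)].

Lemma bd_is_linear : linear bd.
Proof.
move=> s u w; apply/ffunP => T; rewrite !ffunE scale_regE mulr_sumr.
rewrite -big_split; apply: eq_bigr => a _ /=.
by rewrite !ffunE mulrDr scale_regE mulrCA.
Qed.

HB.instance Definition _ :=
  GRing.isLinear.Build R chain chain *:%R bd bd_is_linear.

Definition cobd c : chain :=
  [ffun A : {set 'I_n} => \sum_(a in A) sgn a A * x a * c (A :\ a)].

Lemma cobd_is_linear : linear cobd.
Proof.
move=> s u w; apply/ffunP => T; rewrite !ffunE scale_regE mulr_sumr.
rewrite -big_split; apply: eq_bigr => a _ /=.
by rewrite !ffunE mulrDr scale_regE mulrCA.
Qed.

HB.instance Definition _ :=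
  GRing.isLinear.Build R chain chain *:%R cobd cobd_is_linear.

Lemma cobd_adjoint c w : \sum_T c T * bd w T = \sum_A cobd c A * w A.
Proof.
under eq_bigr do rewrite ffunE mulr_sumr.
under [RHS]eq_bigr do rewrite ffunE mulr_suml.
rewrite (exchange_big_dep predT) //= [RHS](exchange_big_dep predT) //=.
apply: eq_bigr => a _.
rewrite (reindex_onto (fun A => A :\ a) (fun T => a |: T)) /=; last first.
  by move=> T aT; rewrite setU1K.
apply: eq_big => [A|A /andP[_ /eqP aA]].
  rewrite !inE eqxx /=; apply/eqP/idP => [<-|aA]; rewrite ?setU11 //.
  exact: setD1K.
by rewrite aA sgnD1 mulrA [c _ * _]mulrC.
Qed.

Lemma bdK w : bd (bd w) = 0.
Proof.
apply/ffunP => T; rewrite !ffunE.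
pose F a b := sgn a T * x a * (sgn b (a |: T) * x b * w (b |: (a |: T))).
rewrite -[RHS](@sum_antisym [pred a | a \notin T] F).
  apply: eq_bigr => a aT; rewrite ffunE mulr_sumr; apply: eq_bigl => b.
  by rewrite !inE negb_or andbC eq_sym.
move=> a b /= aT bT ab; rewrite /F setUCA [in LHS]mulrA [in RHS]mulrA.
rewrite [in LHS]mulrACA [in RHS]mulrACA sgn_swap // [x b * x a]mulrC.
by rewrite !mulNr.
Qed.

(** Exterior multiplication by e_k on the left. *)
Definition cone k w : chain :=
  [ffun A : {set 'I_n} => if k \in A then sgn k A * w (A :\ k) else 0].

Lemma cone_is_linear k : linear (cone k).
Proof.
move=> s u w; apply/ffunP => A; rewrite !ffunE.
case: ifP => _; last by rewrite scaler0 addr0.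
by rewrite mulrDr !scale_regE mulrCA.
Qed.

HB.instance Definition _ k :=
  GRing.isLinear.Build R chain chain *:%R (cone k) (cone_is_linear k).

(** Exterior multiplication by e_k is a homotopy from multiplication by x_k to
    0. It shows that cycles become boundaries after multiplication by x_k, and
    that cones over chains off k have a nonzero boundary when x_k = 1. *)
Lemma cone_homotopy k w : bd (cone k w) + cone k (bd w) = x k *: w.
Proof.
apply/ffunP => T; rewrite !ffunE; case: ifPn => kT; last first.
  rewrite addr0 (bigD1 k) //= big1 ?addr0 => [|a /andP[aT ak]].
    rewrite ffunE setU11 setU1K // -[sgn k (k |: T)]sgnD1 setU1K //.
    by rewrite mulrACA sgn_sqr mul1r.
  by rewrite ffunE !inE (negPf kT) eq_sym (negPf ak) mulr0.
have [U kU ->] : exists2 U : {set _}, k \notin U & T = k |: U.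
  by exists (T :\ k); rewrite ?setD1K // !inE eqxx.
(* The term a = k of the second sum survives; the others cancel. *)
rewrite setU1K // [X in _ + _ * X](bigD1 k) //= mulrDr addrCA.
rewrite -[sgn k (k |: U)]sgnD1 setU1K // -[sgn k U * x k * _]mulrA.
rewrite (mulrA _ (sgn k U)) sgn_sqr mul1r.
rewrite -[RHS]addr0; congr (_ + _); rewrite mulr_sumr.
rewrite (eq_bigl (fun a => (a \notin U) && (a != k))); last first.
  by move=> a; rewrite !inE negb_or andbC.
rewrite -big_split big1 //= => a /andP[aU ak].
rewrite ffunE !inE eqxx orbT setUCA setU1K; last first.
  by rewrite !inE negb_or eq_sym ak.
rewrite -[sgn k _]sgnD1 setU1K; last by rewrite !inE negb_or eq_sym ak.
rewrite mulrACA sgn_exchange // -[sgn a U * x a * _]mulrA (mulrA (sgn k U)).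
by rewrite [sgn k U * _]mulrC !mulNr mulrA addNr.
Qed.
End Boundary.
End Chains.

(** * Linear algebra on the simplex over a field *)

Section Simplex.
Variables (K : fieldType) (n : nat).
Local Notation chain := {ffun {set 'I_n} -> K^o}.
Local Notation sbd := (@bd K n (fun=> 1)).
Local Notation scobd := (@cobd K n (fun=> 1)).
Implicit Types (k v : 'I_n) (T A : {set 'I_n}).

Lemma card_draws_setC1 v j :
  #|[set T : {set 'I_n} | T \subset ~: [set v] & #|T| == j]| = 'C(n.-1, j).
Proof. by rewrite cards_draws cardsC1 card_ord. Qed.

(** The coboundaries span a space of dimension 'C(n-1, j), so that fewer
    conditions than that cannot kill them all. The unknowns are the values on
    the j-sets that avoid v: for such a cochain c, the coboundary on v |: T is
    c T up to sign. *)
Lemma exists_cocycle_on v j (C : {set {set 'I_n}}) :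
  (#|C| < 'C(n.-1, j))%N ->
  exists c : chain, [/\ forall T, #|T| != j -> c T = 0,
    forall A, A \in C -> scobd c A = 0 &
    exists2 A : {set _}, #|A| = j.+1 & scobd c A != 0].
Proof.
rewrite -(card_draws_setC1 v) => /linear_kernel_support-/(_ K scobd).
case=> c [[T TX cT] cX cC]; exists c; split=> // [A cardA|].
  by apply: cX; rewrite inE negb_and cardA orbT.
move: TX; rewrite inE subsetC sub1set inE => /andP[vT /eqP cardT].
exists (v |: T); first by rewrite cardsU1 vT cardT.
rewrite ffunE (bigD1 v) ?setU11 //= setU1K // big1 ?addr0 => [|a /andP[_ av]].
  by rewrite mulr1 mulf_neq0 // signr_eq0.
by rewrite cX ?mulr0 // inE subsetC sub1set !inE eqxx eq_sym av.
Qed.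

(** The cycles of the simplex off k form a space of dimension 'C(n-2, j) in the
    span of 'C(n-1, j) sets, so that a set L of more than 'C(n-2, j-1) of these
    sets supports a nonzero cycle, and it bounds because the simplex is
    acyclic. Taking the cone with apex v of an unknown chain off k and v
    parametrizes the cycles directly by what they bound. *)
Lemma exists_chain_bd_support k v j (L : {set {set 'I_n}}) : (0 < j)%N ->
  k != v -> L \subset [set T : {set _} | T \subset ~: [set k] & #|T| == j] ->
  ('C(n.-2, j.-1) < #|L|)%N ->
  exists w : chain,
    [/\ forall T : {set _}, w T != 0 -> k \notin T /\ #|T| = j.+1,
        forall T : {set _}, T \notin L -> sbd w T = 0 &
        exists2 T : {set _}, T \in L & sbd w T != 0].
Proof.
set D := [set T | _ & _] => j_gt0 kv sLD ltL.
pose X := [set T : {set _} | T \subset ~: [set k; v] & #|T| == j].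
have n2 : (n.-1 = n.-2.+1)%N.
  have := ltn_ord k; have := ltn_ord v; move: kv; rewrite -val_eqE /=; lia.
have cardX : #|X| = 'C(n.-2, j).
  by rewrite cards_draws cardsCs setCK cards2 kv card_ord subn2.
have ltYX : (#|D :\: L| < #|X|)%N.
  have := binS n.-2 j.-1; rewrite -n2 prednK // => binE.
  rewrite cardsDS // cardX; have := subset_leq_card sLD.
  by rewrite card_draws_setC1 binE => ?; rewrite ltn_subLR // addnC ltn_add2r.
have [w [[T0 T0X wT0] wX wY]] :=
  linear_kernel_support (sbd \o @cone K n v) ltYX.
have supp T : cone v w T != 0 -> k \notin T /\ #|T| = j.+1.
  rewrite ffunE; case: ifP => vT; last by rewrite eqxx.
  have [TX|/wX->] := boolP (T :\ v \in X); last by rewrite mulr0 eqxx.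
  move=> _; move: TX; rewrite inE subsetC subUset !sub1set !inE eqxx andbT.
  rewrite (negPf kv) /= => /andP[kT /eqP <-]; split=> //.
  by rewrite [LHS](cardsD1 v) vT.
have bdL T : T \notin L -> sbd (cone v w) T = 0.
  move=> TL; have [TD|TD] := boolP (T \in D).
    by apply: wY; rewrite inE TL.
  rewrite ffunE big1 // => a aT.
  have [->|/supp[]] := eqVneq (cone v w (a |: T)) 0; first by rewrite mulr0.
  rewrite cardsU1 aT !inE negb_or => /andP[_ kT] /eqP; rewrite eqSS => cardT.
  by move: TD; rewrite inE subsetC sub1set inE kT cardT.
(* A cone with apex v vanishes off v, so the homotopy formula gives w there. *)
have bdT0 : sbd (cone v w) T0 != 0.
  have /ffunP/(_ T0) := @cone_homotopy K n (fun=> 1) v w.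
  rewrite scale1r [LHS]ffunE [X in _ + X]ffunE ifN ?addr0 => [->//|].
  by move: T0X; rewrite inE subsetC subUset !sub1set !inE -andbA => /and3P[].
exists (cone v w); split=> //; exists T0 => //.
by apply: contraNT bdT0 => /bdL ->.
Qed.
End Simplex.

(** * From the simplex to the Koszul complex *)

Section MonomialScaling.
Variables (K : fieldType) (n : nat).
Local Notation S := {mpoly K[n]}.
Local Notation X := (fun a => 'X_a : S).
Local Notation sbd := (@bd K n (fun=> 1)).
Local Notation scobd := (@cobd K n (fun=> 1)).
Local Notation kbd := (@bd S n X).
Local Notation kcobd := (@cobd S n X).

Implicit Types (U T A : {set 'I_n}).

Definition sqfree (U : {set 'I_n}) : S := \prod_(b in U) 'X_b.

Lemma meval_sqfree (p : 'I_n -> K) U :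
  (forall b, b \in U -> p b = 1) -> (sqfree U).@[p] = 1.
Proof.
by move=> p1; rewrite rmorph_prod big1 // => b /p1 pb; rewrite /= mevalXU.
Qed.

Lemma sqfree_neq0 U : sqfree U != 0.
Proof.
apply/eqP => /(congr1 (meval (fun=> 1))) /eqP.
by rewrite meval_sqfree // meval0 oner_eq0.
Qed.

Lemma sgn_mpolyC a T : sgn S a T = (sgn K a T)%:MP.
Proof. by rewrite /sgn rmorph_sign. Qed.

(** Removing a vertex from T adds its variable to the product over U :\: T,
    which is exactly the factor that the Koszul differential produces. *)
Definition scale_chain U (w : {ffun {set 'I_n} -> K^o}) :
    {ffun {set 'I_n} -> S^o} :=
  [ffun T : {set 'I_n} => (w T)%:MP * sqfree (U :\: T)].

Lemma bd_scale_chain U (w : {ffun {set 'I_n} -> K^o}) :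
  (forall T, w T != 0 -> T \subset U) ->
  kbd (scale_chain U w) = scale_chain U (sbd w).
Proof.
move=> wU; apply/ffunP => T; rewrite !ffunE rmorph_sum mulr_suml.
apply: eq_bigr => a aT; rewrite ffunE mulr1 rmorphM sgn_mpolyC.
have [->|/wU] := eqVneq (w (a |: T)) 0.
  by rewrite rmorph0 !(mulr0, mul0r).
rewrite subUset sub1set => /andP[aU _].
have -> : sqfree (U :\: T) = 'X_a * sqfree (U :\: (a |: T)).
  by rewrite /sqfree (big_setD1 a) ?inE ?aU ?aT //= setDDl setUC.
by rewrite mulrACA.
Qed.

(** The factor is complementary to that of [scale_chain] on the full simplex:
    scaled chains and cochains pair like the original ones, times the product
    of all variables. *)
Definition scale_cochain (c : {ffun {set 'I_n} -> K^o}) :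
    {ffun {set 'I_n} -> S^o} :=
  [ffun T : {set 'I_n} => (c T)%:MP * sqfree T].

Lemma cobd_scale_cochain c :
  kcobd (scale_cochain c) = scale_cochain (scobd c).
Proof.
apply/ffunP => A; rewrite !ffunE rmorph_sum mulr_suml.
apply: eq_bigr => a aA; rewrite ffunE mulr1 rmorphM sgn_mpolyC.
have -> : sqfree A = 'X_a * sqfree (A :\ a).
  by rewrite /sqfree (big_setD1 a).
by rewrite mulrACA.
Qed.
End MonomialScaling.

Section KoszulChains.
Variables (K : fieldType) (n : nat).
Local Notation S := {mpoly K[n]}.
Local Notation kbd := (@bd S n (fun a => 'X_a)).

(** The degree j part of a chain. *)
Definition of_chain j (w : {ffun {set 'I_n} -> S^o}) : koszul K n j :=
  [ffun A => w (val A)].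

Lemma of_chain_is_linear j : linear (@of_chain j).
Proof. by move=> s u w; apply/ffunP => A; rewrite !ffunE. Qed.

HB.instance Definition _ j := GRing.isLinear.Build S
  {ffun {set 'I_n} -> S^o} (koszul K n j) *:%R (@of_chain j)
  (@of_chain_is_linear j).

Lemma kdiff_of_chain j w : (0 < j)%N ->
  kdiff (of_chain j w) = of_chain j.-1 (kbd w).
Proof.
move=> j_gt0; apply/ffunP => B; rewrite sum_ffunE !ffunE.
under eq_bigr do rewrite !ffunE scale_regE sum_ffunE mulr_sumr.
rewrite (exchange_big_dep predT) //= [RHS]big_mkcond; apply: eq_bigr => a _.
have [aB|aB] := boolP (a \in val B) => /=.
  rewrite big1 // => A aA; rewrite !ffunE scale_regE.
  by case: eqP => [BA|_]; rewrite ?mulr0 //; move: aB; rewrite BA !inE eqxx.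
have cardA : #|a |: val B| == j.
  by rewrite cardsU1 aB (eqP (valP B)) add1n prednK.
pose aUB : ksub n j := exist (fun A : {set 'I_n} => #|A| == j) _ cardA.
rewrite (bigD1 aUB) /= ?setU11 //= big1 ?addr0.
  rewrite !ffunE /= setU1K // eqxx scale_regE mulr1 mulrC; congr (_ * _ * _).
  by rewrite -/(sgn S a _) -sgnD1 setU1K.
move=> A /andP[aA neqA]; rewrite !ffunE scale_regE.
case: eqP => [BA|_]; rewrite ?mulr0 //; case/eqP: neqA; apply: val_inj.
by rewrite /= BA setD1K.
Qed.

Lemma kspanP j (B : {set ksub n j}) (u : koszul K n j) :
  reflect (forall A, A \notin B -> u A = 0) (u \in kspan K B).
Proof.
apply: (iffP (@spanP _ _ _ _ _ _)) => [[c ->] A AB|uB].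
  rewrite sum_ffunE big1 // => C CB; rewrite !ffunE scale_regE.
  by case: eqP => [/val_inj eqAC|_]; rewrite ?mulr0 //; rewrite eqAC CB in AB.
exists (fun A => u A); apply/ffunP => A; rewrite sum_ffunE.
have [AB|AB] := boolP (A \in B).
  rewrite (bigD1 A) //= big1 => [|C /andP[_ CA]].
    by rewrite !ffunE eqxx scale_regE mulr1 addr0.
  by rewrite !ffunE (inj_eq val_inj) eq_sym (negPf CA) scaler0.
rewrite uB // big1 // => C CB; rewrite !ffunE (inj_eq val_inj).
by case: eqP => [eqAC|_]; rewrite ?scaler0 //; rewrite eqAC CB in AB.
Qed.

(** Extending u by 0 to the sets of cardinality other than j gives w. *)
Lemma kspan_of_chain j (B : {set ksub n j}) (u : koszul K n j) :
  u \in kspan K B -> exists2 w, u = of_chain j w &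
    forall A : {set 'I_n}, A \notin [set val C | C in B] -> w A = 0.
Proof.
move=> /kspanP uB; exists [ffun A => oapp u 0 (insub A)].
  by apply/ffunP => A; rewrite !ffunE valK.
move=> A AB; rewrite ffunE; case: insubP => //= C _ CA.
by apply: uB; apply: contra AB => CB; rewrite -CA imset_f.
Qed.
End KoszulChains.

Section Detection.
Variables (K : fieldType) (n : nat).
Local Notation S := {mpoly K[n]}.
Local Notation scobd := (@cobd K n (fun=> 1)).

Lemma kdiffZ j (s : S) (u : koszul K n j) : kdiff (s *: u) = s *: kdiff u.
Proof. exact: linearZ. Qed.

Lemma kdiffB j (u w : koszul K n j) : kdiff (u - w) = kdiff u - kdiff w.
Proof. exact: linearB. Qed.

(** Pairing with the scaled cochain c of degree i - 1 depends only on the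
    differential, and by adjointness it reads off the coordinates weighted by
    the coboundary of c. Where this coboundary vanishes nothing is seen; hence
    if u and w agree elsewhere outside T, they also agree at T. *)
Lemma cocycle_detects i (c : {ffun {set 'I_n} -> K^o})
    (u w : {ffun {set 'I_n} -> S^o}) (T : {set 'I_n}) : (0 < i)%N ->
  (forall A : {set 'I_n}, #|A| != i.-1 -> c A = 0) ->
  scobd c T != 0 -> (forall A, A != T -> scobd c A = 0 \/ u A = w A) ->
  kdiff (of_chain i u) = kdiff (of_chain i w) -> u T = w T.
Proof.
move=> i_gt0 c_card cT cuw; rewrite !kdiff_of_chain // => eq_bd.
have : \sum_A scale_cochain (scobd c) A * u A =
    \sum_A scale_cochain (scobd c) A * w A.
  rewrite -cobd_scale_cochain -!cobd_adjoint; apply: eq_bigr => A _.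
  have [cardA|/c_card cA] := boolP (#|A| == i.-1); last first.
    by rewrite !ffunE cA rmorph0 !mul0r.
  have /ffunP/(_ (exist (fun A : {set 'I_n} => #|A| == i.-1) _ cardA)) := eq_bd.
  by rewrite [LHS]ffunE [RHS]ffunE /= => ->.
rewrite (bigD1 T) //= [RHS](bigD1 T) //=.
rewrite [X in _ + X](eq_bigr (fun A => scale_cochain (scobd c) A * w A)).
  have cT0 : scale_cochain (scobd c) T != 0.
    by rewrite ffunE mulf_neq0 ?mpolyC_eq0 ?sqfree_neq0.
  by move=> /addIr/(mulfI cT0).
by move=> A /cuw[cA|->] //; rewrite [scale_cochain _ _]ffunE cA rmorph0 !mul0r.
Qed.
End Detection.

(** * Consequences of the Bourbaki sequence *)

Section LinearForms.
Variables (R : comNzRingType) (U : lmodType R) (psi : {linear U -> R^o}).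

Lemma linear_formZ (s : R) u : psi (s *: u) = s * psi u.
Proof. by rewrite linearZ. Qed.

(** Any two vectors are dependent modulo the kernel of a linear form: this is
    how the rank of an ideal being at most 1 is used. *)
Lemma linear_form_cross u v : psi ((psi v : R) *: u - (psi u : R) *: v) = 0.
Proof. by rewrite linearB /= !linear_formZ mulrC subrr. Qed.
End LinearForms.

Section BourbakiKoszul.
Variables (K : fieldType) (n i : nat) (B : {set ksub n i}).
Hypothesis hB : bourbaki_sequence (@kspan_gr K n i B) (@cycles_gr K n i)
  (@kquot_gr K n i B) (kdiff_restr K B) (kquot_proj K B).
Local Notation S := {mpoly K[n]}.
Local Notation sbd := (@bd K n (fun=> 1)).
Local Notation kbd := (@bd S n (fun a => 'X_a)).
Local Notation kd := (@kdiff K n i).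

(** The quotient Z_i / F is isomorphic to an ideal, hence embeds in S; composing
    with the differential turns the embedding into a linear form on K_i. *)
Lemma exists_form_kernel : exists psi : {linear koszul K n i -> S^o},
  forall u, psi u = 0 <-> exists2 f, f \in kspan K B & kd u = kd f.
Proof.
have [I [m [_ [f [bij_f _]]]]] := bs_ideal hB.
pose phi : {linear kquot K B -> S^o} := @submod_val _ _ I \o f.
have phi_inj : injective phi.
  by move=> p q /= /val_inj; exact: (bij_inj bij_f).
exists (phi \o (kquot_proj K B \o corestr kd)) => u.
transitivity (kquot_proj K B (corestr kd u) = 0).
  split=> [u0|/(congr1 phi) u0]; last exact: etrans u0 (raddf0 phi).
  by apply: phi_inj; apply: etrans u0 (esym (raddf0 phi)).
rewrite (bs_exact hB); split=> [[[g gB] /(congr1 val) ug]|[g gB ug]].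
  by exists g.
by exists (Submod gB); apply: val_inj.
Qed.

Lemma kspan_kdiff_inj f : f \in kspan K B -> kd f = 0 -> f = 0.
Proof.
move=> fB f0; suff /(congr1 val) : Submod fB = 0 by [].
apply: (bs_injective hB); rewrite raddf0; apply: val_inj.
exact: f0.
Qed.

(** Otherwise the coboundary of some c1 vanishes on B but not at a set T1, and
    that of some c2 vanishes on B and at T1 but not at a set T2. The
    differentials of e_T1 and e_T2 satisfy a relation modulo F because Z_i / F
    has rank at most 1. By c2 the coefficient of the second is 0; it is the
    value of the linear form at e_T1, so that the first lies in the image of F,
    which c1 excludes. *)
Lemma card_basis_ge (v : 'I_n) : (0 < i)%N -> ('C(n.-1, i.-1) <= #|B|.+1)%N.
Proof.
move=> i_gt0; rewrite leqNgt; apply/negP => ltB.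
have [psi psiE] := exists_form_kernel.
set C := [set val A | A in B].
have leC : (#|C| <= #|B|)%N := leq_imset_card _ _.
have [c1 [c1_card c1C [T1 _ c1T1]]] :=
  exists_cocycle_on K v (leq_ltn_trans leC (ltnW ltB)).
have ltC1 : (#|T1 |: C| < 'C(n.-1, i.-1))%N.
  by rewrite cardsU1; apply: leq_ltn_trans ltB; rewrite -add1n leq_add ?leq_b1.
have [c2 [c2_card c2C [T2 _ c2T2]]] := exists_cocycle_on K v ltC1.
pose e (T : {set 'I_n}) : {ffun {set 'I_n} -> S^o} := [ffun A => (A == T)%:R].
pose Psi : {linear {ffun {set 'I_n} -> S^o} -> S^o} := psi \o @of_chain K n i.
pose p (T : {set 'I_n}) : S := Psi (e T).
have p1 : p T1 = 0.
  have /psiE[f /kspan_of_chain[w -> wB]] :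
      Psi (p T2 *: e T1 - p T1 *: e T2) = 0.
    exact: linear_form_cross.
  move=> /(cocycle_detects i_gt0 c2_card c2T2).
  have T2C1 : T2 \notin T1 |: C by apply: contraNN c2T2 => /c2C->.
  move: (T2C1); rewrite !inE negb_or => /andP[/negPf T21 T2C].
  rewrite !ffunE T21 eqxx wB // !scale_regE mulr0 mulr1 sub0r => E.
  apply/eqP; rewrite -oppr_eq0; apply/eqP/E => A /negPf AT2.
  have [/c2C|] := boolP (A \in T1 |: C); first by left.
  rewrite !inE negb_or => /andP[/negPf AT1 AC]; right.
  by rewrite !ffunE AT1 AT2 wB // !scale_regE !mulr0 subr0.
have /psiE[f /kspan_of_chain[w -> wB]] := p1.
move=> /(cocycle_detects i_gt0 c1_card c1T1).
have T1C : T1 \notin C by apply: contraNN c1T1 => /c1C->.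
rewrite !ffunE eqxx wB // => E.
suff /eqP : (1 : S) = 0 by rewrite oner_eq0.
apply: E => A /negPf AT1; have [/c1C|AC] := boolP (A \in C); first by left.
by right; rewrite !ffunE AT1 wB.
Qed.

(** The element G of F constructed here has differential 'X_k times the
    differential of W, so that torsion freeness of Z_i / F and injectivity on F
    make G divisible by 'X_k. But W comes from the simplex without k, so that
    the nonzero coefficients of G are, up to scalars, monomials in the other
    variables. *)
Lemma card_link_le (k : 'I_n) : (1 < i < n)%N ->
  (#|[set A in B | k \in val A]| <= 'C(n.-2, i.-2))%N.
Proof.
move=> /andP[i_gt1 lt_in]; rewrite leqNgt; apply/negP => ltBk.
have i_gt0 : (0 < i)%N := ltnW i_gt1.
have [v kv] : exists v, k != v.
  have /card_gt1P[v [v' [_ _ vv']]] : (1 < #|'I_n|)%N.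
    by rewrite card_ord; lia.
  by have [kv|] := eqVneq k v; [exists v'; rewrite kv | exists v].
set Bk := [set A in B | _] in ltBk.
pose L := [set val A :\ k | A in Bk].
have link_inj (A A' : ksub n i) : k \in val A -> k \in val A' ->
    val A :\ k = val A' :\ k -> A = A'.
  by move=> kA kA' eqA; apply: val_inj; rewrite -(setD1K kA) eqA setD1K.
have cardL : #|L| = #|Bk|.
  apply: card_in_imset => A A'; rewrite !inE => /andP[_ kA] /andP[_ kA'].
  exact: link_inj.
have sL : L \subset [set T : {set _} | T \subset ~: [set k] & #|T| == i.-1].
  apply/subsetP => _ /imsetP[A ABk ->]; move: ABk; rewrite !inE => /andP[_ kA].
  have : #|val A| = i := eqP (valP A).
  rewrite (cardsD1 k) kA => /(congr1 predn) /= cardA.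
  by rewrite subsetC sub1set !inE eqxx; apply/eqP.
have ltL : ('C(n.-2, i.-1.-1) < #|L|)%N by rewrite cardL.
have j_gt0 : (0 < i.-1)%N by lia.
have [w [w_supp wL [T TL wT]]] := exists_chain_bd_support K j_gt0 kv sL ltL.
pose W := scale_chain (~: [set k]) w; pose G := cone k (kbd W).
have WE : kbd W = scale_chain (~: [set k]) (sbd w).
  apply: bd_scale_chain => T' /w_supp[kT' _].
  by rewrite subsetC sub1set inE.
have GB : of_chain i G \in kspan K B.
  apply/kspanP => A AB; rewrite 2![LHS]ffunE; case: ifP => // kA.
  rewrite WE ffunE wL ?rmorph0 ?mul0r ?mulr0 //.
  apply: contra AB => /imsetP[A']; rewrite !inE => /andP[A'B kA'].
  by move=> /(link_inj _ _ kA kA')->.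
have GW : kdiff (of_chain i G) = 'X_k *: kdiff (of_chain i W).
  rewrite !kdiff_of_chain // -linearZ; congr of_chain.
  rewrite -(cone_homotopy (fun a => 'X_a) k (kbd W)) bdK.
  by rewrite raddf0 addr0.
have [psi psiE] := exists_form_kernel.
have Xk_neq0 : 'X_k != 0 :> S.
  by have := sqfree_neq0 K [set k]; rewrite /sqfree big_set1.
have /psiE[f fB Wf] : psi (of_chain i W) = 0.
  have : psi ('X_k *: of_chain i W) = 0.
    apply/(psiE ('X_k *: of_chain i W)); exists (of_chain i G); first exact: GB.
    by rewrite kdiffZ GW.
  by move=> /eqP; rewrite linear_formZ mulf_eq0 (negPf Xk_neq0) => /eqP.
have GXf : of_chain i G = 'X_k *: f.
  apply/eqP; rewrite -subr_eq0; apply/eqP/kspan_kdiff_inj.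
    by rewrite rpredB ?rpredZ.
  by rewrite kdiffB kdiffZ GW Wf subrr.
have /imsetP[A] := TL; rewrite inE => /andP[_ kA] TA.
have /ffunP/(_ A) := GXf; rewrite 2![LHS]ffunE kA -TA WE ffunE [RHS]ffunE.
rewrite scale_regE.
(* At the point with k-th coordinate 0 and all others 1, the multiple of 'X_k
   vanishes, whereas the coefficient of G is that of the boundary of w up to
   sign. *)
move=> /(congr1 (meval (fun b => (b != k)%:R))) /eqP.
rewrite !mevalM mevalXU eqxx mul0r mevalC meval_sqfree ?mulr1; last first.
  by move=> b; rewrite !inE => /andP[_ ->].
by rewrite sgn_mpolyC mevalC mulf_eq0 (negPf wT) orbF signr_eq0.
Qed.
End BourbakiKoszul.

(** * Counting *)

(** With 'C(n-2, i-2) = a, 'C(n-2, i-1) = b, 'C(n-2, i) = p, 'C(n-2, i+1) = q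
    and 'C(n-1, i-2) = a', one has i * (a + b) = n * a + b, and the hypotheses
    give b <= i. The first term of the maximum is n * a + b - n * a' with
    a <= a', and the second is b - n * q. *)
Lemma binomial_bounds (n i c : nat) : (2 <= i <= n.-1)%N ->
  ('C(n.-1, i.-1) <= c.+1)%N -> (c * i <= n * 'C(n.-2, i.-2))%N ->
  Num.max
    (i%:Z * ('C(n.-1, i.-1))%:Z - n%:Z * ('C(n.-1, i.-2))%:Z)
    ((n%:Z - i%:Z) * ('C(n.-1, i))%:Z - n%:Z * ('C(n.-1, i.+1))%:Z) <= i%:Z.
Proof.
case: n i => [|[|m]] [|[|j]] //= lt_jm; rewrite ?ltnS in lt_jm.
have := mul_bin_diag m.+1 j; have := mul_bin_down m.+1 j.+2 => /=.
have := leq_bin2l j (leqnSn m).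
have -> : 'C(m.+1, j.+3) = ('C(m, j.+3) + 'C(m, j.+2))%N := binS _ _.
have -> : 'C(m.+1, j.+2) = ('C(m, j.+2) + 'C(m, j.+1))%N := binS _ _.
have -> : 'C(m.+1, j.+1) = ('C(m, j.+1) + 'C(m, j))%N := binS _ _.
move: 'C(m.+1, j) 'C(m, j) 'C(m, j.+1) 'C(m, j.+2) 'C(m, j.+3).
move=> a' a b p q le_aa' down diag le_bac le_cna.
have le_ba : (j.+2 * (b + a) <= j.+2 + m.+2 * a)%N by nia.
have le_bj : (b <= j.+2)%N by nia.
have downZ : (m%:Z - j%:Z) * (p%:Z + b%:Z) = m.+2%:Z * p%:Z + b%:Z by nia.
have le_naa' : (m.+2 * a <= m.+2 * a')%N by rewrite leq_mul2l le_aa' orbT.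
rewrite ge_max; apply/andP; split; lia.
Qed.

Theorem theorem5p4 (K : fieldType) (n i : nat) (hi : (2 <= i <= n.-1)%N)
    (B : {set ksub n i})
    (hB : bourbaki_sequence (@kspan_gr K n i B) (@cycles_gr K n i)
            (@kquot_gr K n i B) (kdiff_restr K B) (kquot_proj K B)) :
  Num.max
    (i%:Z * ('C(n.-1, i.-1))%:Z - n%:Z * ('C(n.-1, i.-2))%:Z)
    ((n%:Z - i%:Z) * ('C(n.-1, i))%:Z - n%:Z * ('C(n.-1, i.+1))%:Z) <= i%:Z.
Proof.
have n_gt0 : (0 < n)%N by lia.
have card_ge := card_basis_ge hB (Ordinal n_gt0) ltac:(lia).
have link_le k := card_link_le hB k ltac:(lia).
have double_count : (\sum_(k < n) #|[set A in B | k \in val A]| = #|B| * i)%N.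
  under eq_bigr do rewrite -sum1dep_card big_mkcondr.
  rewrite exchange_big -sum_nat_const /=; apply: eq_bigr => A _.
  by rewrite -big_mkcond sum1_card (eqP (valP A)).
have le_nC : (#|B| * i <= n * 'C(n.-2, i.-2))%N.
  rewrite -double_count -[n in (n * _)%N]card_ord -sum_nat_const.
  by apply: leq_sum => k _; apply: link_le.
exact: binomial_bounds hi card_ge le_nC.
Qed.
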